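(* Let $k\ge 6$ and $4\le t\le k+1$ be integers, and assume it is not the case that both $t=4$ and $k$ is odd. Then for every positive integer $n$, $$r_k(\mathcal{H}^k_t,\,2kn)\;>\;2^{\,r_{k-1}(\mathcal{H}^{k-1}_{t-1},\,n)-1}.$$
   Context: A $k$-uniform hypergraph ($k$-graph) is a collection of $k$-element subsets (edges) of a vertex set; $K^k_N$ denotes the complete $k$-graph on $N$ vertices. $\mathcal{H}^k_t$ denotes the family of $k$-graphs with $k+1$ vertices and $t$ edges, and $r_k(\mathcal{H}^k_t,n)$ is the minimum $N$ such that every red/blue coloring of the edges of $K^k_N$ yields either an $n$-vertex set all of whose $k$-subsets are blue, or a set of $k+1$ vertices containing at least $t$ red $k$-subsets (i.e. $r_k(\mathcal{H}^k_t,n)=r_k(k+1,t;n)$). Similarly $r_{k-1}(\mathcal{H}^{k-1}_{t-1},n)$ is the minimum $N$ such that every red/blue coloring of the $(k-1)$-subsets of an $N$-set yields an $n$-set with all $(k-1)$-subsets blue or a $k$-set containing at least $t-1$ red $(k-1)$-subsets. *)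

(* Defs.v *)
From mathcomp Require Import all_boot.

Set Implicit Arguments.
Unset Strict Implicit.
Unset Printing Implicit Defensive.

(* A k-graph on the vertex set 'I_N is given by its edge set. *)
Definition complete_kgraph (k N : nat) : {set {set 'I_N}} :=
  [set e : {set 'I_N} | #|e| == k].

Definition induced_edges (N : nat) (E : {set {set 'I_N}}) (S : {set 'I_N}) :
  {set {set 'I_N}} := [set e in E | e \subset S].

(* A red/blue colouring of the edges of K^k_N is given by its set of red edges,
   a subset of complete_kgraph k N; the blue edges are the remaining ones. *)
Definition ramsey_arrow (k s t n N : nat) : bool :=
  [forall red : {set {set 'I_N}}, (red \subset complete_kgraph k N) ==>
     ([exists S : {set 'I_N}, (#|S| == n) &&
         (induced_edges (complete_kgraph k N) S
            \subset complete_kgraph k N :\: red)]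
      || [exists S : {set 'I_N}, (#|S| == s) &&
            (t <= #|induced_edges red S|)])].

Lemma finite_ramsey (k a b : nat) :
  exists N, forall (T : finType) (A : {set T}) (c : {set T} -> bool),
    N <= #|A| ->
    (exists2 S : {set T}, S \subset A & #|S| = a /\
       forall e : {set T}, e \subset S -> #|e| = k -> c e) \/
    (exists2 S : {set T}, S \subset A & #|S| = b /\
       forall e : {set T}, e \subset S -> #|e| = k -> ~~ c e).
Proof.
have sub (T : finType) (A : {set T}) m :
    m <= #|A| -> exists2 S : {set T}, S \subset A & #|S| = m.
  rewrite -bin_gt0 -cards_draws card_gt0 => /set0Pn[S].
  by rewrite inE => /andP[SA /eqP cS]; exists S.
elim: k a b => [|k IHk] a b.
  exists (a + b) => T A c leNA.
  have [S1 S1A cS1] := sub T A a (leq_trans (leq_addr _ _) leNA).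
  have [S2 S2A cS2] := sub T A b (leq_trans (leq_addl _ _) leNA).
  case c0: (c set0).
    by left; exists S1 => //; split=> // e _ /cards0_eq ->.
  by right; exists S2 => //; split=> // e _ /cards0_eq ->; rewrite c0.
elim: a b => [|a IHa] b.
  exists 0 => T A c _; left; exists set0; rewrite ?sub0set ?cards0 //.
  by split=> // e; rewrite subset0 => /eqP ->; rewrite cards0.
elim: b => [|b [N2 IHb]].
  exists 0 => T A c _; right; exists set0; rewrite ?sub0set ?cards0 //.
  by split=> // e; rewrite subset0 => /eqP ->; rewrite cards0.
have [N1 {}IHa] := IHa b.+1.
have [M {}IHk] := IHk N1 N2.
have ext (T : finType) (x : T) (S : {set T}) (P : pred {set T}) :
    (forall e : {set T}, e \subset S -> #|e| = k -> P (x |: e)) ->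
    forall S' : {set T}, S' \subset S ->
    (forall e : {set T}, e \subset S' -> #|e| = k.+1 -> P e) ->
    forall e : {set T}, e \subset x |: S' -> #|e| = k.+1 -> P e.
  move=> Px S' S'S PS' e eS' ce.
  have eD : e :\ x \subset S' by rewrite subDset.
  case: (boolP (x \in e)) => xe.
    rewrite -(setD1K xe); apply: Px; first exact: subset_trans eD S'S.
    by move: ce; rewrite (cardsD1 x) xe => -[].
  by apply: PS' => //; apply: subset_trans eD; rewrite subsetD1 subxx.
exists M.+1 => T A c leMA.
have /set0Pn[x xA] : A != set0 by rewrite -card_gt0 (leq_trans _ leMA).
have leM : M <= #|A :\ x| by move: leMA; rewrite (cardsD1 x) xA.
have xN (S : {set T}) : S \subset A :\ x -> x \notin S.
  by move=> SA; apply/negP => /(subsetP SA); rewrite !inE eqxx.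
have xS (S : {set T}) : S \subset A :\ x -> x |: S \subset A.
  by move=> SA; rewrite subUset sub1set xA (subset_trans SA) ?subsetDl.
have SA' (S : {set T}) : S \subset A :\ x -> S \subset A.
  by move=> SA; rewrite (subset_trans SA) ?subsetDl.
have [[S SA [cS HS]]|[S SA [cS HS]]] :=
  IHk T (A :\ x) (fun e => c (x |: e)) leM.
- have [[U US [cU HU]]|[U US [cU HU]]] := IHa T S c (eq_leq (esym cS)).
    left; exists (x |: U); first exact/xS/(subset_trans US).
    split; first by rewrite cardsU1 xN ?cU //; apply: subset_trans SA.
    exact: (ext T x S c HS U).
  by right; exists U => //; apply/SA'/(subset_trans US).
have [[U US [cU HU]]|[U US [cU HU]]] := IHb T S c (eq_leq (esym cS)).
  by left; exists U => //; apply/SA'/(subset_trans US).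
right; exists (x |: U); first exact/xS/(subset_trans US).
split; first by rewrite cardsU1 xN ?cU //; apply: subset_trans SA.
exact: (ext T x S (fun e => ~~ c e) HS U).
Qed.

Lemma ramsey_arrow_exists (k s t n : nat) :
  t <= 'C(s, k) -> exists N, ramsey_arrow k s t n N.
Proof.
move=> let_s; have [N HN] := finite_ramsey k s n.
exists N; apply/forallP => red; apply/implyP => redK; apply/orP.
have leN : N <= #|[set: 'I_N]| by rewrite cardsT card_ord.
have [[S _ [cS HS]]|[S _ [cS HS]]] := HN _ [set: 'I_N] (fun e => e \in red) leN.
  right; apply/existsP; exists S; rewrite cS eqxx /=.
  apply: (leq_trans let_s); rewrite -cS -cards_draws; apply/subset_leq_card.
  by apply/subsetP => e; rewrite !inE => /andP[eS /eqP ce]; rewrite eS andbT HS.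
left; apply/existsP; exists S; rewrite cS eqxx /=.
apply/subsetP => e; rewrite !inE => /andP[ce eS]; rewrite ce andbT.
exact: HS (eqP ce).
Qed.

(* r_k(s, t; n), for t <= 'C(s, k). For t > 'C(s, k) the minimum need not exist
   (the all-red colouring avoids both options when n >= k) and the value is the
   default 0. *)
Definition ramsey_number (k s t n : nat) : nat :=
  if @idP (t <= 'C(s, k)) is ReflectT le_t
  then ex_minn (ramsey_arrow_exists n le_t) else 0.

Lemma ramsey_numberP (k s t n : nat) : t <= 'C(s, k) ->
  ramsey_arrow k s t n (ramsey_number k s t n) /\
  forall N, ramsey_arrow k s t n N -> ramsey_number k s t n <= N.
Proof.
rewrite /ramsey_number => let_s.
by case: {-}_ / idP => // h; case: ex_minnP.
Qed.

(* r_k(H^k_t, n) = r_k(k+1, t; n). *)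
Definition ramsey_H (k t n : nat) : nat := ramsey_number k k.+1 t n.

(* Main.v *)
Require Import Defs.
From mathcomp Require Import all_boot zify.

(** Stepping-up with zigzags.  Let [N] be one less than the Ramsey number of
uniformity [k - 1] and fix a colouring of the [(k - 1)]-subsets of [N] points
that witnesses it.  The vertices are numbers below [2 ^ N]; a [k]-set
[v_0 < ... < v_(k-1)] has deltas [d_i], the position of the leading binary
digit where [v_i] and [v_(i+1)] differ.  Colour it red if its deltas are
monotone and form a red [(k - 1)]-set, or if [d_0 < d_1 > d_2 < ...].

Consecutive deltas are distinct, and removing an inner vertex replaces two
adjacent deltas by their maximum.  In a [(k + 1)]-set with monotone deltas, the
red [k]-subsets give red [(k - 1)]-subsets of the set of its [k] deltas, and
only two of them give the same one.  If the deltas are not monotone, only a few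
neighbouring vertices can be removed to obtain a monotone or zigzag sequence: at
most 3 of them, or 4 when [k] is odd.

In a blue set of [2 k n] vertices, either some [n] consecutive deltas are
monotone, and they form a blue [n]-set, or every block of [2 n] deltas contains
a local minimum, and these minima with the maxima between them give a red
zigzag. *)

Set Implicit Arguments.
Unset Strict Implicit.
Unset Printing Implicit Defensive.

(** * Leading differing digits *)

Lemma eq_divn_pow2_exists (u v : nat) : exists c, u %/ 2 ^ c == v %/ 2 ^ c.
Proof.
exists (u + v); rewrite !divn_small //.
  by apply: leq_ltn_trans (leq_addl u v) _; apply: ltn_expl.
by apply: leq_ltn_trans (leq_addr v u) _; apply: ltn_expl.
Qed.

(** Dividing by [2 ^ c] drops the [c] lowest binary digits. For [u <> v] the level is one more than
    the position of the leading differing digit. *)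
Definition agree_level (u v : nat) : nat := ex_minn (eq_divn_pow2_exists u v).

(* The position (counted from 0) of the leading binary digit where u and v
   differ; the junk value for u = v is 0. *)
Definition delta (u v : nat) : nat := (agree_level u v).-1.

Lemma agree_level_leP u v c : (agree_level u v <= c) = (u %/ 2 ^ c == v %/ 2 ^ c).
Proof.
rewrite /agree_level; case: ex_minnP => m /eqP Em min.
apply/idP/idP => [le_mc | /min //].
by rewrite -(subnK le_mc) addnC expnD !divnMA Em.
Qed.

Lemma agree_level_gt0 u v : u < v -> 0 < agree_level u v.
Proof.
by move=> uv; rewrite ltnNge agree_level_leP expn0 !divn1 neq_ltn uv.
Qed.

(** Division preserves order, so once the quotients of [u] and [w] agree, that of [v] is squeezed
    between them. *)
Lemma agree_level_max u v w : u < v -> v < w ->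
  agree_level u w = maxn (agree_level u v) (agree_level v w).
Proof.
move=> uv vw; apply/eqP; rewrite eqn_leq geq_max !agree_level_leP.
have huv c : u %/ 2 ^ c <= v %/ 2 ^ c by apply/leq_div2r/ltnW.
have hvw c : v %/ 2 ^ c <= w %/ 2 ^ c by apply/leq_div2r/ltnW.
have L1 := leq_maxl (agree_level u v) (agree_level v w).
have L2 := leq_maxr (agree_level u v) (agree_level v w).
rewrite agree_level_leP in L1; rewrite agree_level_leP in L2.
rewrite (eqP L1) L2 /=.
have := leqnn (agree_level u w); rewrite agree_level_leP => /eqP E.
move: (huv (agree_level u w)) (hvw (agree_level u w)); rewrite E => h1 h2.
have /anti_leq -> : v %/ 2 ^ agree_level u w <= w %/ 2 ^ agree_level u w
  <= v %/ 2 ^ agree_level u w by rewrite h1 h2.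
by rewrite eqxx.
Qed.

(** With a common level [c.+1], the quotients by [2 ^ c] would be three distinct numbers with the
    same half. *)
Lemma agree_level_neq u v w : u < v -> v < w ->
  agree_level u v != agree_level v w.
Proof.
move=> uv vw; apply/eqP => E.
have := leqnn (agree_level u v); rewrite agree_level_leP => /eqP Euv.
have := leqnn (agree_level v w); rewrite agree_level_leP => /eqP Evw.
have := agree_level_gt0 uv; move: E Euv Evw.
case Ec: (agree_level u v) => [//|c] E; rewrite -E => Euv Evw _.
have: ~~ (agree_level u v <= c) by rewrite Ec ltnn.
have: ~~ (agree_level v w <= c) by rewrite -E ltnn.
rewrite !agree_level_leP.
have huv : u %/ 2 ^ c <= v %/ 2 ^ c by apply/leq_div2r/ltnW.
have hvw : v %/ 2 ^ c <= w %/ 2 ^ c by apply/leq_div2r/ltnW.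
move: Euv Evw huv hvw; rewrite expnSr !divnMA.
by move: (u %/ 2 ^ c) (v %/ 2 ^ c) (w %/ 2 ^ c) => x y z; lia.
Qed.

Lemma delta_max u v w : u < v -> v < w ->
  delta u w = maxn (delta u v) (delta v w).
Proof. by move=> uv vw; rewrite /delta (agree_level_max uv vw); lia. Qed.

Lemma delta_neq u v w : u < v -> v < w -> delta u v <> delta v w.
Proof.
move=> uv vw; have := agree_level_neq uv vw.
by have := agree_level_gt0 uv; have := agree_level_gt0 vw; rewrite /delta; lia.
Qed.

Lemma delta_lt u v N : u < v -> v < 2 ^ N -> delta u v < N.
Proof.
move=> uv vN; have uN := ltn_trans uv vN.
have := agree_level_gt0 uv.
have : agree_level u v <= N by rewrite agree_level_leP !divn_small.
by rewrite /delta; lia.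
Qed.

(** * Sequences with a prescribed up-down pattern *)

Definition follows (p : pred nat) (a : nat -> nat) (m : nat) : bool :=
  all (fun i => if p i then a i < a i.+1 else a i.+1 < a i) (iota 0 m.-1).

Lemma followsP p a m :
  reflect (forall i, i.+1 < m -> if p i then a i < a i.+1 else a i.+1 < a i)
    (follows p a m).
Proof.
apply: (iffP allP) => H i; last by rewrite mem_iota => ?; apply: H; lia.
by move=> ?; apply: H; rewrite mem_iota; lia.
Qed.

Lemma eq_follows p a b m : (forall i, i < m -> a i = b i) ->
  follows p a m = follows p b m.
Proof.
by move=> E; apply/followsP/followsP => H i im; have := H i im; rewrite !E //; lia.
Qed.

Definition zigzag : pred nat := fun i => ~~ odd i.

(* If a lists the deltas of consecutive vertices of an increasing sequence,
   then del a j lists the deltas once the j-th vertex is removed. *)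
Definition del (a : nat -> nat) (j i : nat) : nat :=
  if i.+1 < j then a i else if i.+1 == j then maxn (a i) (a i.+1) else a i.+1.

Lemma del_step_lt p a m j i : follows p (del a j) m -> i.+1 < m -> i.+2 < j ->
  if p i then a i < a i.+1 else a i.+1 < a i.
Proof.
move=> /followsP H /H; rewrite /del => + lt_j.
by rewrite lt_j (ltn_trans (ltnSn _) lt_j).
Qed.

Lemma del_step_ge p a m j i : follows p (del a j) m -> i.+1 < m -> j <= i ->
  if p i then a i.+1 < a i.+2 else a i.+2 < a i.+1.
Proof.
move=> /followsP H /H; rewrite /del => + le_j.
have -> : (i.+1 < j) = false by lia.
have -> : (i.+1 == j) = false by lia.
have -> : (i.+2 < j) = false by lia.
by have -> : (i.+2 == j) = false by lia.
Qed.

Lemma del_step_l p a m i : follows p (del a i.+2) m -> i.+1 < m ->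
  if p i then a i < maxn (a i.+1) (a i.+2) else maxn (a i.+1) (a i.+2) < a i.
Proof. by move=> /followsP H /H; rewrite /del ltnn eqxx ltnSn. Qed.

Lemma del_step_r p a m i : follows p (del a i.+1) m -> i.+1 < m ->
  if p i then maxn (a i) (a i.+1) < a i.+2 else a i.+2 < maxn (a i) (a i.+1).
Proof. by move=> /followsP H /H; rewrite /del ltnn eqxx [_ < i.+1]ltnNge leqnSn gtn_eqF. Qed.

(** Each entry of [del a j] is one delta or the maximum of two neighbours, so every prescribed step
    is already visible at one of two adjacent steps of [a]. *)
Lemma del_step_sub p a m j i : follows p (del a j) m -> i.+1 < m ->
  if p i then a i < a i.+1 \/ a i.+1 < a i.+2
  else a i.+1 < a i \/ a i.+2 < a i.+1.
Proof.
move=> H im.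
have [lt_j|] := ltnP i.+2 j; first by have := del_step_lt H im lt_j; case: ifP; lia.
rewrite leq_eqVlt => /predU1P[Ej|]; first subst j.
  by have := del_step_l H im; case: ifP; lia.
rewrite ltnS leq_eqVlt => /predU1P[Ej|lt_j]; first subst j.
  by have := del_step_r H im; case: ifP; lia.
by have := del_step_ge H im lt_j; case: ifP; lia.
Qed.

(** * Removals that leave a monotone or zigzag sequence *)

(** Merging the upper end with an earlier delta only raises it. The descent disappears only if its
    ends are merged ([i.+1]), its lower end is raised or dropped ([i.+2]), or its upper end is the
    first delta and is dropped ([0]). *)
Lemma inc_del_down a k j i : j <= k -> follows predT (del a j) k.-1 ->
  i.+1 < k -> a i.+1 < a i -> j \in [:: 0; i.+1; i.+2].
Proof.
move=> jk H ik down; rewrite !inE.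
have [lt_j|ge_j] := ltnP i.+2 j; first by have /= := del_step_lt H _ lt_j; lia.
case: i ik down ge_j => [|i] ik down ge_j; first by lia.
have [lt_j|] := leqP j i; first by have /= := del_step_ge H _ lt_j; lia.
rewrite leq_eqVlt => /predU1P[Ej|]; last by lia.
by subst j; have /= := del_step_r H; lia.
Qed.

Lemma dec_del_up a k j i : j <= k -> follows pred0 (del a j) k.-1 ->
  i.+1 < k -> a i < a i.+1 -> j \in [:: i; i.+1; k].
Proof.
move=> jk H ik up; rewrite !inE.
have [lt_j|] := ltnP i.+2 j; first by have /= := del_step_lt H _ lt_j; lia.
rewrite leq_eqVlt => /predU1P[Ej|ge_j].
  by subst j; have /= := del_step_l H; lia.
case: i ik up ge_j => [|i] ik up ge_j; first by lia.
by have [lt_j|] := leqP j i; [have /= := del_step_ge H _ lt_j|]; lia.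
Qed.

(** One removal would destroy both descents. Removing vertex [0] spares the later one. For adjacent
    descents the common candidate is [i.+2], whose merge yields [a i.+1], still below [a i]. *)
Lemma inc_del_down_uniq a k j i i' : j <= k -> follows predT (del a j) k.-1 ->
  i < i' -> i'.+1 < k -> a i.+1 < a i -> a i'.+1 < a i' -> False.
Proof.
move=> jk H ii' ik down down'.
have := inc_del_down jk H (ltn_trans _ ik) down; rewrite ltnS => /(_ ii').
have := inc_del_down jk H ik down'; rewrite !inE => m1 m2.
have [Ej|j0] := posnP j.
  subst j; case: i' ii' ik down' {m1 m2} => [//|i'] ii' ik down'.
  by have /= := @del_step_ge _ _ _ _ i' H; lia.
have Ei : i' = i.+1 by lia.
have Ej : j = i.+2 by lia.
by subst i' j; have /= := del_step_l H; lia.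
Qed.

Lemma dec_del_up_uniq a k j i i' : j <= k -> follows pred0 (del a j) k.-1 ->
  i < i' -> i'.+1 < k -> a i < a i.+1 -> a i' < a i'.+1 -> False.
Proof.
move=> jk H ii' ik up up'.
have := dec_del_up jk H (ltn_trans _ ik) up; rewrite ltnS => /(_ ii').
have := dec_del_up jk H ik up'; rewrite !inE => m1 m2.
have [Ejk|jk'] := eqVneq j k.
  subst j; case: i' ii' ik up' {m1 m2} => [//|i'] ii' ik up'.
  by have /= := @del_step_lt _ _ _ _ i H; lia.
have Ei : i' = i.+1 by lia.
have Ej : j = i.+1 by lia.
by subst i' j; have /= := del_step_r H; lia.
Qed.

(** There is at most one descent and at most one ascent, but the first three steps are all one or
    the other. *)
Lemma inc_dec_del_false a k j j' : 5 < k -> j <= k -> j' <= k ->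
  (forall i, i.+1 < k -> a i <> a i.+1) ->
  follows predT (del a j) k.-1 -> follows pred0 (del a j') k.-1 -> False.
Proof.
move=> k5 jk j'k neq Hj Hj'.
have := inc_del_down_uniq jk Hj; have := dec_del_up_uniq j'k Hj' => U D.
have := neq 0; have := neq 1; have := neq 2.
have := U 0 1; have := U 1 2; have := U 0 2.
have := D 0 1; have := D 1 2; have := D 0 2; lia.
Qed.

(** The zigzag descends at steps 1 and 3, which forces one descent of [a] at 1 or 2 and another at 3
    or 4. *)
Lemma inc_zigzag_del_false a k j j' : 5 < k -> j <= k ->
  follows predT (del a j) k.-1 -> follows zigzag (del a j') k.-1 -> False.
Proof.
move=> k5 jk Hj Hj'; have D := inc_del_down_uniq jk Hj.
have /= := @del_step_sub _ _ _ _ 1 Hj'; have /= := @del_step_sub _ _ _ _ 3 Hj'.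
by have := D 1 3; have := D 1 4; have := D 2 3; have := D 2 4; lia.
Qed.

Lemma dec_zigzag_del_false a k j j' : 5 < k -> j <= k ->
  follows pred0 (del a j) k.-1 -> follows zigzag (del a j') k.-1 -> False.
Proof.
move=> k5 jk Hj Hj'; have U := dec_del_up_uniq jk Hj.
have /= := @del_step_sub _ _ _ _ 0 Hj'; have /= := @del_step_sub _ _ _ _ 2 Hj'.
by have := U 0 2; have := U 0 3; have := U 1 2; have := U 1 3; lia.
Qed.

(** If [j + 4 <= j'], the step from [a j.+1] to [a j.+2] is step [j] after one removal and step
    [j.+1] after the other, and these have opposite directions. *)
Lemma zigzag_del_window a k j j' : j' <= k ->
  follows zigzag (del a j) k.-1 -> follows zigzag (del a j') k.-1 ->
  j' < j + 4.
Proof.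
move=> jk Hj Hj'; rewrite ltnNge; apply/negP => le_j.
have := @del_step_lt _ _ _ _ j.+1 Hj'; have := @del_step_ge _ _ _ _ j Hj.
by rewrite /zigzag /=; case: (odd j) => /=; lia.
Qed.

(** The two outer removals already conflict: for odd [j] in the order of [a j] and [a j.+1], for
    even [j] in that of [a j.+1] and [a j.+2]. *)
Lemma zigzag_del_window_even a k j : 5 < k -> ~~ odd k -> j + 3 <= k ->
  (forall j', j <= j' < j + 4 -> follows zigzag (del a j') k.-1) -> False.
Proof.
move=> k5 evk jk H.
have H0 : follows zigzag (del a j) k.-1 by apply: H; lia.
have H3 : follows zigzag (del a j.+3) k.-1 by apply: H; lia.
case oj: (odd j).
  case: j jk H H0 H3 oj => [//|j] jk H H0 H3 /= oj.
  have := @del_step_lt _ _ _ _ j H3; have := @del_step_lt _ _ _ _ j.+1 H3.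
  have := @del_step_ge _ _ _ _ j.+1 H0; have := @del_step_r _ _ _ j H0.
  by rewrite /zigzag /= (negbTE oj) /=; lia.
(* As [j] and [k] are both even, [j + 3 <= k] is strict, so step [j.+1] exists after the removal of
   [j.+3]. *)
have := @del_step_lt _ _ _ _ j H3; have := @del_step_ge _ _ _ _ j H0.
have := @del_step_ge _ _ _ _ j.+1 H0; have := @del_step_l _ _ _ j.+1 H3.
by rewrite /zigzag /= oj /=; lia.
Qed.

(** The three outcomes exclude each other, so one successful removal fixes the kind of all. A
    descent, an ascent or the zigzag window then confines the positions. *)
Lemma del_red_cover a k : 5 < k ->
  (forall i, i.+1 < k -> a i <> a i.+1) ->
  ~~ follows predT a k -> ~~ follows pred0 a k ->
  exists2 L : seq nat, size L <= 3 + odd k &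
    forall j, j <= k ->
      [|| follows predT (del a j) k.-1, follows pred0 (del a j) k.-1
        | follows zigzag (del a j) k.-1] -> j \in L.
Proof.
move=> k5 neq /allPn[i0 + down] /allPn[i1 + up].
rewrite !mem_iota !add0n /= => hi0 hi1.
have {}down : a i0.+1 < a i0 by have := neq i0; move: down => /=; lia.
have {}up : a i1 < a i1.+1 by have := neq i1; move: up => /=; lia.
have [/hasP[j0 + H0]|/hasPn Ninc] :=
    boolP (has (fun j => follows predT (del a j) k.-1) (iota 0 k.+1)).
  rewrite mem_iota => hj0; exists [:: 0; i0.+1; i0.+2]; first by case: odd.
  move=> j jk /or3P[] H.
  - by apply: (inc_del_down jk H) => //; lia.
  - by case: (@inc_dec_del_false a k j0 j k5 _ jk neq H0 H); lia.
  - by case: (@inc_zigzag_del_false a k j0 j k5 _ H0 H); lia.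
have [/hasP[j0 + H0]|/hasPn Ndec] :=
    boolP (has (fun j => follows pred0 (del a j) k.-1) (iota 0 k.+1)).
  rewrite mem_iota => hj0; exists [:: i1; i1.+1; k]; first by case: odd.
  move=> j jk /or3P[] H.
  - by have /Ninc/negP[] : j \in iota 0 k.+1 by rewrite mem_iota; lia.
  - by apply: (dec_del_up jk H) => //; lia.
  - by case: (@dec_zigzag_del_false a k j0 j k5 _ H0 H); lia.
pose Z j := (j <= k) && follows zigzag (del a j) k.-1.
have redZ j : j <= k -> [|| follows predT (del a j) k.-1,
    follows pred0 (del a j) k.-1 | follows zigzag (del a j) k.-1] -> Z j.
  move=> jk; have jI : j \in iota 0 k.+1 by rewrite mem_iota; lia.
  by rewrite (negbTE (Ninc j jI)) (negbTE (Ndec j jI)) /Z jk.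
have [/hasP[j1 _ Hj1]|/hasPn NZ] := boolP (has Z (iota 0 k.+1)); last first.
  exists [::] => // j jk /(redZ j jk) Zj.
  by have /NZ/negP[] : j \in iota 0 k.+1 by rewrite mem_iota; lia.
have exZ : exists j, Z j by exists j1.
case: (ex_minnP exZ) => m /andP[mk Zm] minm.
(* The window starts at the least zigzag removal [m], so it contains all of them. *)
exists [seq j <- iota m 4 | Z j]; last first.
  move=> j jk /(redZ j jk) Zj; rewrite mem_filter Zj mem_iota minm //=.
  by case/andP: Zj => _ Zj; have := zigzag_del_window jk Zm Zj; lia.
case ok: (odd k).
  by apply: leq_trans (_ : size (iota m 4) <= _); rewrite ?size_filter ?count_size.
(* For even [k] a filtered window of full size 4 would make all four removals zigzag. *)
rewrite size_filter addn0 -ltnS -[4 in X in _ < X](size_iota m 4).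
rewrite ltn_neqAle count_size -all_count andbT; apply/negP => /allP allZ.
apply: (@zigzag_del_window_even a k m) => //; first by rewrite ok.
  by rewrite addnC; have /allZ/andP[] : m.+3 \in iota m 4 by rewrite mem_iota; lia.
by move=> j hj; have /allZ/andP[] : j \in iota m 4 by rewrite mem_iota.
Qed.

(** * Finite sets of numbers and their deltas *)

Definition elts (n : nat) (e : {set 'I_n}) : seq nat := [seq val x | x <- enum e].

(** Entries of [s] that are not below [n] are dropped, hence the bounds assumed in the lemmas on
    [setof]. *)
Definition setof (n : nat) (s : seq nat) : {set 'I_n} := [set x : 'I_n | val x \in s].

Lemma size_elts n (e : {set 'I_n}) : size (elts e) = #|e|.
Proof. by rewrite size_map cardE. Qed.

Lemma mem_elts n (e : {set 'I_n}) (x : 'I_n) : (val x \in elts e) = (x \in e).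
Proof. by rewrite mem_map ?mem_enum //; apply: val_inj. Qed.

Lemma elts_lt n (e : {set 'I_n}) i : i \in elts e -> i < n.
Proof. by case/mapP => x _ ->; apply: ltn_ord. Qed.

Lemma elts_sorted n (e : {set 'I_n}) : sorted ltn (elts e).
Proof.
have : sorted ltn [seq val x | x <- Finite.enum 'I_n].
  by rewrite -enumT val_enum_ord iota_ltn_sorted.
rewrite !sorted_map => srt; rewrite /enum_mem; apply: sorted_filter srt.
by move=> x y z; apply: ltn_trans.
Qed.

Lemma mem_elts_setof n s : {in s, forall i, i < n} -> elts (setof n s) =i s.
Proof.
move=> lt i; apply/idP/idP => [/mapP[x]|si]; first by rewrite mem_enum inE => ? ->.
by apply/mapP; exists (Ordinal (lt i si)); rewrite ?mem_enum ?inE.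
Qed.

Lemma setofK n s : sorted ltn s -> {in s, forall i, i < n} -> elts (setof n s) = s.
Proof.
move=> srt /mem_elts_setof.
exact: (irr_sorted_eq ltn_trans ltnn (elts_sorted _) srt).
Qed.

Lemma uniq_elts n (e : {set 'I_n}) : uniq (elts e).
Proof. by rewrite map_inj_uniq ?enum_uniq //; apply: val_inj. Qed.

Lemma card_setof n s : uniq s -> {in s, forall i, i < n} -> #|setof n s| = size s.
Proof.
move=> us lt; rewrite -size_elts; apply/perm_size/uniq_perm => //.
  exact: uniq_elts.
exact: mem_elts_setof.
Qed.

Definition vtx n (e : {set 'I_n}) : nat -> nat := nth 0 (elts e).

Lemma vtx_ltn n (e : {set 'I_n}) i j : i < j -> j < #|e| -> vtx e i < vtx e j.
Proof.
rewrite -size_elts => ij je; apply: (sorted_ltn_nth ltn_trans) => //.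
- exact: elts_sorted.
- by rewrite inE (ltn_trans ij je).
Qed.

Lemma mem_vtx n (e : {set 'I_n}) i : i < #|e| -> vtx e i \in elts e.
Proof. by rewrite -size_elts => ?; apply: mem_nth. Qed.

Definition deltas n (e : {set 'I_n}) (i : nat) : nat := delta (vtx e i) (vtx e i.+1).

Lemma deltas_lt M N (e : {set 'I_M}) i : M <= 2 ^ N -> i.+1 < #|e| -> deltas e i < N.
Proof.
move=> MN ie; apply: delta_lt; first exact: vtx_ltn.
exact: leq_trans (elts_lt (mem_vtx ie)) MN.
Qed.

Lemma deltas_neq M (e : {set 'I_M}) i : i.+2 < #|e| -> deltas e i <> deltas e i.+1.
Proof. by move=> ie; apply: delta_neq; apply: vtx_ltn => //; apply: ltnW. Qed.

(** [h] gives the positions of the retained vertices; [bump j] thus removes the [j]-th one. *)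
Definition subvtx n (e : {set 'I_n}) (h : nat -> nat) (m : nat) : {set 'I_n} :=
  setof n (mkseq (vtx e \o h) m).

Lemma homo_step (h : nat -> nat) m : (forall i, i.+1 < m -> h i < h i.+1) ->
  forall i j, i < j -> j < m -> h i < h j.
Proof.
move=> H i; elim=> // j IHj; rewrite ltnS leq_eqVlt => /predU1P[<-|ij] jm.
  exact: H.
exact: ltn_trans (IHj ij (ltnW jm)) (H _ jm).
Qed.

Lemma subvtxP n (e : {set 'I_n}) h m :
    (forall i, i.+1 < m -> h i < h i.+1) -> (forall i, i < m -> h i < #|e|) ->
  [/\ subvtx e h m \subset e, #|subvtx e h m| = m &
      forall i, i < m -> vtx (subvtx e h m) i = vtx e (h i)].
Proof.
move=> hS he; set s := mkseq (vtx e \o h) m.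
have srt : sorted ltn s.
  apply/(sortedP 0) => i; rewrite size_mkseq => im.
  by rewrite !nth_mkseq //= ?(ltnW im) //; apply: vtx_ltn; [apply: hS|apply: he].
have lt : {in s, forall i, i < n}.
  move=> _ /mapP[i + ->]; rewrite mem_iota => im.
  by apply/elts_lt/mem_vtx/he.
split.
- apply/subsetP => x; rewrite inE => /mapP[i]; rewrite mem_iota => im xi.
  by rewrite -mem_elts xi; apply/mem_vtx/he.
- by rewrite card_setof ?size_mkseq //; apply: sorted_uniq srt; [exact: ltn_trans|exact: ltnn].
- by move=> i im; rewrite /vtx setofK // nth_mkseq.
Qed.

Lemma subvtx_deltas n (e : {set 'I_n}) h m :
    (forall i, i.+1 < m -> h i < h i.+1) -> (forall i, i < m -> h i < #|e|) ->
  forall i, i.+1 < m ->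
    deltas (subvtx e h m) i = delta (vtx e (h i)) (vtx e (h i.+1)).
Proof.
move=> hS he i im; have [_ _ E] := subvtxP hS he.
by rewrite /deltas !E // ltnW.
Qed.

Lemma deltas_del n (e : {set 'I_n}) k j : #|e| = k.+1 -> j <= k ->
  forall i, i.+1 < k -> deltas (subvtx e (bump j) k) i = del (deltas e) j i.
Proof.
move=> ek jk i ik; rewrite subvtx_deltas //; last first.
- by move=> l; rewrite ek /bump; case: leqP; lia.
- by move=> l; rewrite /bump; do 2!case: leqP; lia.
rewrite /del /bump; case: ltnP => h1.
  by have -> : (j <= i) = false by lia.
case: eqP => [Ej|ne].
  subst j; rewrite ltnn add0n add1n; apply: delta_max; apply: vtx_ltn; lia.
by have -> : j <= i by lia.
Qed.

(** Iterating [delta_max], the delta of two vertices is the maximum of the consecutive deltas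
    between them. On a monotone run it sits at one end, as the next two lemmas use. *)
Lemma deltas_le_delta n (e : {set 'I_n}) i l j :
  i <= l -> l <= j -> j.+1 < #|e| -> deltas e l <= delta (vtx e i) (vtx e j.+1).
Proof.
move=> il; elim: j => [|j IHj] lj je.
  have -> : i = 0 by lia.
  by have -> : l = 0 by lia.
have [Ei|ij] := eqVneq i j.+1.
  rewrite Ei; have -> : l = j.+1 by lia.
  exact: leqnn.
rewrite (@delta_max _ (vtx e j.+1)); last 2 first.
- by apply: vtx_ltn; lia.
- by apply: vtx_ltn; lia.
have [->|lj'] := eqVneq l j.+1; first exact: leq_maxr.
by apply: leq_trans (leq_maxl _ _); apply: IHj; lia.
Qed.

Lemma delta_inc n (e : {set 'I_n}) i j : i <= j -> j.+1 < #|e| ->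
  (forall l, i <= l -> l < j -> deltas e l < deltas e l.+1) ->
  delta (vtx e i) (vtx e j.+1) = deltas e j.
Proof.
move=> ij; rewrite -(subnKC ij); elim: (j - i) => [|m IHm] je inc.
  by rewrite addn0.
rewrite (@delta_max _ (vtx e (i + m).+1)); last 2 first.
- by apply: vtx_ltn; lia.
- by apply: vtx_ltn; lia.
rewrite IHm; first last.
- by move=> l ? ?; apply: inc; lia.
- by lia.
by rewrite addnS; apply/maxn_idPr/ltnW/inc; lia.
Qed.

Lemma delta_dec n (e : {set 'I_n}) i j : i <= j -> j.+1 < #|e| ->
  (forall l, i <= l -> l < j -> deltas e l.+1 < deltas e l) ->
  delta (vtx e i) (vtx e j.+1) = deltas e i.
Proof.
move=> ij; rewrite -(subKn ij); elim: (j - i) (leq_subr i j) => [|m IHm] mj je dec.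
  by rewrite subn0.
have E : (j - m.+1).+1 = j - m by lia.
rewrite (@delta_max _ (vtx e (j - m))); last 2 first.
- by apply: vtx_ltn; lia.
- by apply: vtx_ltn; lia.
rewrite IHm; first last.
- by move=> l ? ?; apply: dec; lia.
- by lia.
- by lia.
rewrite -E; apply/maxn_idPl/ltnW/dec; lia.
Qed.

(** * Few red edges on k + 1 vertices *)

Definition red_deltas (k N : nat) (red : {set {set 'I_N}}) (b : nat -> nat) : bool :=
  (follows predT b k.-1 || follows pred0 b k.-1) && (setof N (mkseq b k.-1) \in red)
  || follows zigzag b k.-1.

Lemma eq_red_deltas k N (red : {set {set 'I_N}}) b b' :
  (forall i, i.+1 < k -> b i = b' i) -> red_deltas k red b = red_deltas k red b'.
Proof.
move=> E; have E' i : i < k.-1 -> b i = b' i by move=> ?; apply: E; lia.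
rewrite /red_deltas !(eq_follows _ E'); congr (_ && (setof N _ \in red) || _).
by apply/eq_in_map => i; rewrite mem_iota => ?; apply: E'; lia.
Qed.

Definition step_up (k N M : nat) (red : {set {set 'I_N}}) : {set {set 'I_M}} :=
  [set e in complete_kgraph k M | red_deltas k red (deltas e)].

Lemma subset_card_bump M (S e : {set 'I_M}) k : #|S| = k.+1 -> #|e| = k ->
  e \subset S -> exists j : 'I_k.+1, e = subvtx S (bump j) k.
Proof.
move=> cS ce eS.
have /cards1P[x Ex] : #|S :\: e| == 1.
  by rewrite cardsD (setIidPr eS) cS ce subSnn.
have /setDP[xS xNe] : x \in S :\: e by rewrite Ex set11.
have eE : e = S :\ x by rewrite -Ex setDDr setDv set0U (setIidPr eS).
have jlt : index (val x) (elts S) < k.+1.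
  by rewrite -cS -size_elts index_mem mem_elts.
have [j vj] : exists j : 'I_k.+1, vtx S j = val x.
  by exists (Ordinal jlt); rewrite /vtx nth_index ?mem_elts.
exists j; have [||sub cs _] := @subvtxP _ S (bump j) k.
- by move=> l; rewrite /bump; do 2!case: leqP; lia.
- by move=> l; rewrite cS /bump; case: leqP; lia.
apply/eqP; rewrite eq_sym eqEcard cs ce leqnn andbT eE subsetD1 sub /=.
rewrite inE; apply/mapP => -[l]; rewrite mem_iota /= -vj => lk Ej.
have ne : nat_of_ord j <> bump j l by have := neq_bump j l; lia.
have bl : bump j l < #|S| by rewrite cS /bump; case: leqP; lia.
have jS : j < #|S| by rewrite cS.
have [lt|gt|//] := ltngtP j (bump j l).
  by have := vtx_ltn lt bl; rewrite Ej /= ltnn.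
by have := vtx_ltn gt jS; rewrite Ej /= ltnn.
Qed.

Lemma card_red_del M (S : {set 'I_M}) k N (red : {set {set 'I_N}}) : #|S| = k.+1 ->
  #|induced_edges (step_up k M red) S|
    <= #|[set j : 'I_k.+1 | red_deltas k red (del (deltas S) j)]|.
Proof.
move=> cS; set J := [set j | _].
apply: leq_trans (leq_imset_card (fun j : 'I_k.+1 => subvtx S (bump j) k) J).
apply/subset_leq_card/subsetP => e; rewrite !inE => /andP[/andP[/eqP ce re] eS].
have [j ej] := subset_card_bump cS ce eS; apply/imsetP; exists j => //.
rewrite inE; move: re; rewrite ej (@eq_red_deltas _ _ _ _ (del (deltas S) j)) //.
by apply: deltas_del => //; rewrite -ltnS.
Qed.

Lemma card_ord_cover k (J : {set 'I_k}) (L : seq nat) :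
  (forall j : 'I_k, j \in J -> val j \in L) -> #|J| <= size L.
Proof.
move=> H; rewrite -size_elts; apply: uniq_leq_size; first exact: uniq_elts.
by move=> _ /mapP[j + ->]; rewrite mem_enum => /H.
Qed.

Lemma mem_setof_bump (N k : nat) (a : nat -> nat) (i i' : 'I_k) (x : 'I_N) :
  {in [pred l | l < k] &, injective a} -> val x = a i ->
  (x \in setof N (mkseq (a \o bump i') k.-1)) = (i != i').
Proof.
move=> inj xi; rewrite inE xi; apply/mapP/idP => [[l]|ne].
  rewrite mem_iota /= => lk /inj; rewrite !inE => E; apply/eqP => ii'; subst i'.
  have bk : bump i l < k by move: lk; rewrite /bump; case: leqP; lia.
  by have := neq_bump i l; rewrite -(E (ltn_ord i) bk) eqxx.
have {}ne : (i : nat) != i' by [].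
exists (unbump i' i); last by rewrite /= unbumpK.
by rewrite mem_iota /unbump; have := ltn_ord i; have := ltn_ord i'; by move: ne; case: ltnP; lia.
Qed.

(** The [i]-th set is the only one that misses [a i], so different [i] give different sets. *)
Lemma card_bump_edges N k (red : {set {set 'I_N}}) a :
  {in [pred l | l < k] &, injective a} -> (forall i, i < k -> a i < N) ->
  #|[set i : 'I_k | setof N (mkseq (a \o bump i) k.-1) \in red]|
    <= #|induced_edges red (setof N (mkseq a k))|.
Proof.
move=> inj aN; set I := [set i | _].
pose g (i : 'I_k) := setof N (mkseq (a \o bump i) k.-1).
have ginj : injective g.
  move=> i i' E; pose x := Ordinal (aN i (ltn_ord i)).
  have := @mem_setof_bump N k a i i x inj erefl; rewrite -/(g i) E.
  by rewrite (@mem_setof_bump N k a i i' x inj erefl) eqxx => /negbFE/eqP.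
rewrite -(card_imset _ ginj); apply/subset_leq_card/subsetP => _ /imsetP[i + ->].
rewrite !inE => -> /=; apply/subsetP => x; rewrite !inE => /mapP[l].
rewrite mem_iota /= => lk ->; apply/map_f; rewrite mem_iota /=.
by have := ltn_ord i; rewrite /bump; case: leqP; lia.
Qed.

Lemma follows_inc a m : follows predT a m ->
  forall i j, i < j -> j < m -> a i < a j.
Proof. by move/followsP => H; apply: homo_step. Qed.

Lemma follows_dec a m : follows pred0 a m ->
  forall i j, i < j -> j < m -> a j < a i.
Proof.
move/followsP => H i; elim=> // j IHj; rewrite ltnS leq_eqVlt => /predU1P[->|ij] jm.
  exact: H.
exact: ltn_trans (H _ jm) (IHj ij (ltnW jm)).
Qed.

Lemma follows_inj p a m : p = predT \/ p = pred0 -> follows p a m ->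
  {in [pred l | l < m] &, injective a}.
Proof.
move=> Hp H i j; rewrite !inE => im jm E; case: Hp H => -> H.
  by have := follows_inc H; move=> inc; have := inc i j; have := inc j i; lia.
by have := follows_dec H; move=> dec; have := dec i j; have := dec j i; lia.
Qed.

(* When the deltas are monotone, removing vertex lift x i amounts to removing
   the i-th delta; here x is the first or the last vertex, which deletes the
   same delta as its neighbour. *)
Lemma card_red_del_monotone N k (red : {set {set 'I_N}}) a p (x : 'I_k.+1) : 4 < k ->
  p = predT \/ p = pred0 -> follows p a k -> (forall i, i < k -> a i < N) ->
  (forall (i : 'I_k) l, l.+1 < k -> del a (lift x i) l = a (bump i l)) ->
  #|[set j : 'I_k.+1 | red_deltas k red (del a j)]|
    <= #|induced_edges red (setof N (mkseq a k))|.+1.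
Proof.
move=> k4 Hp pa aN dE; have inj := follows_inj Hp pa.
apply: leq_trans (_ : _ <= #|[set i : 'I_k |
    setof N (mkseq (a \o bump i) k.-1) \in red]|.+1) _; last first.
  by rewrite ltnS card_bump_edges.
set J := [set j | _]; set I := [set i | _].
apply: (@leq_trans #|x |: lift x @: I|); last first.
  by rewrite cardsU1 (leq_add (leq_b1 _) (leq_imset_card _ _)).
apply/subset_leq_card/subsetP => j; rewrite inE => redj.
rewrite !inE; case: (unliftP x j) redj => [i|] ->; last by rewrite eqxx.
case/orP => [/andP[_ +]|zz].
  move=> redi; apply/orP; right; apply/imset_f; rewrite inE.
  suff <- : mkseq (del a (lift x i)) k.-1 = mkseq (a \o bump i) k.-1 by [].
  by apply/eq_in_map => l; rewrite mem_iota => ?; apply: dE; lia.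
(* A zigzag after the removal would leave both an ascent and a descent in the monotone [a]. *)
move: pa => /followsP pa.
have /= := @del_step_sub _ _ _ _ 0 zz; have /= := @del_step_sub _ _ _ _ 1 zz.
by have := pa 0; have := pa 1; have := pa 2; case: Hp => -> /=; lia.
Qed.

(** Monotone deltas span at most [t - 2] red sets, and the doubled removal adds one. Otherwise the
    cover has size at most [3 + odd k], below [t]. *)
Lemma step_up_sparse M N k t (S : {set 'I_M}) (red : {set {set 'I_N}}) :
  5 < k -> 3 + odd k < t -> M <= 2 ^ N -> #|S| = k.+1 ->
  (forall A : {set 'I_N}, #|A| = k -> #|induced_edges red A| < t - 1) ->
  #|induced_edges (step_up k M red) S| < t.
Proof.
move=> k5 kt MN cS sparse; apply: leq_ltn_trans (card_red_del red cS) _.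
set a := deltas S.
have aN i : i < k -> a i < N by move=> ?; apply: deltas_lt => //; rewrite cS.
have mono p : p = predT \/ p = pred0 -> follows p a k ->
    #|induced_edges red (setof N (mkseq a k))| < t - 1.
  move=> Hp pa; apply: sparse; rewrite card_setof ?size_mkseq //.
    rewrite map_inj_in_uniq ?iota_uniq // => i j; rewrite !mem_iota => ? ?.
    by apply: (follows_inj Hp pa).
  by move=> _ /mapP[i + ->]; rewrite mem_iota; apply: aN.
have [inc|Ninc] := boolP (follows predT a k).
  have Hp : @predT nat = predT \/ @predT nat = pred0 by left.
  apply: (@leq_ltn_trans #|induced_edges red (setof N (mkseq a k))|.+1); last first.
    by have := mono _ Hp inc; lia.
  (* Removing vertex [0] or [1] drops the first, smallest delta, so vertex [0] is set aside. *)
  apply: (@card_red_del_monotone _ _ _ _ predT ord0 (ltnW k5) Hp inc aN).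
  move=> i l lk; rewrite /del lift0 /bump !ltnS eqSS; have := followsP _ _ _ inc l lk => /= h.
  by case: ltngtP => //= *; rewrite ?add0n ?add1n //; apply/maxn_idPr; lia.
have [dec|Ndec] := boolP (follows pred0 a k).
  have Hp : @pred0 nat = predT \/ @pred0 nat = pred0 by right.
  apply: (@leq_ltn_trans #|induced_edges red (setof N (mkseq a k))|.+1); last first.
    by have := mono _ Hp dec; lia.
  (* Now removing either of the last two vertices drops the last, smallest delta. *)
  apply: (@card_red_del_monotone _ _ _ _ pred0 ord_max (ltnW k5) Hp dec aN).
  move=> i l lk; rewrite /del lift_max /bump; have := followsP _ _ _ dec l lk => /= h.
  case: ltngtP => //= [?|?|<-].
  - by rewrite leqNgt (ltn_trans (ltnSn l)).
  - by rewrite -ltnS; have -> : i < l.+1 by [].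
  - by rewrite ltnn add0n; apply/maxn_idPl; lia.
have neq i : i.+1 < k -> a i <> a i.+1 by move=> ?; apply: deltas_neq; rewrite cS.
have [L szL cover] := del_red_cover k5 neq Ninc Ndec.
apply: leq_ltn_trans kt; apply: leq_trans szL; apply: card_ord_cover => j.
rewrite inE => redj; apply: cover; first exact: (ltn_ord j).
by case/orP: redj => [/andP[/orP[]->]|->]; rewrite ?orbT.
Qed.

(** * No large blue sets *)

(* Merging the deltas strictly between two chosen ones keeps only their maximum,
   so picking the upper end of each chosen step (increasing case) or the lower
   end (decreasing case) realises any subsequence of a monotone run. *)
Lemma monotone_subrun M (S : {set 'I_M}) p i n (g : nat -> nat) m :
    p = predT \/ p = pred0 -> follows p (fun l => deltas S (i + l)) n ->
    i + n < #|S| -> 0 < m ->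
    (forall l, l.+1 < m -> g l < g l.+1) -> (forall l, l < m -> i <= g l < i + n) ->
  exists h : nat -> nat,
    [/\ forall l, l.+1 < m.+1 -> h l < h l.+1, forall l, l < m.+1 -> h l < #|S| &
        forall l, l < m -> delta (vtx S (h l)) (vtx S (h l.+1)) = deltas S (g l)].
Proof.
move=> Hp /followsP pa iS m0 gS gi.
have step l : i <= l -> l.+1 < i + n ->
    if p l then deltas S l < deltas S l.+1 else deltas S l.+1 < deltas S l.
  move=> il ln; have := pa (l - i); rewrite addnS subnKC // => H.
  by case: Hp H => -> /=; apply; lia.
case: Hp step {pa} => -> step; rewrite /= in step.
  exists (fun l => if l is l'.+1 then (g l').+1 else g 0); split.
  - by case=> [|l] /= lm; [|rewrite ltnS; apply: gS].
  - move=> l lm; apply: leq_trans iS; rewrite ltnS; case: l lm => [|l] /= lm.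
      by have := gi 0; lia.
    by have := gi l; lia.
  - case=> [|l] /= lm //; apply: delta_inc; first exact: gS.
      by have := gi l.+1; lia.
    by move=> x ? ?; apply: step; have := gi l; have := gi l.+1; lia.
exists (fun l => if l < m then g l else (g m.-1).+1); split.
- move=> l; rewrite ltnS => lm; rewrite lm; case: (ltnP l.+1 m) => lm'; first exact: gS.
  by have -> : m.-1 = l by lia.
- by move=> l lm; case: (ltnP l m) => ?; [have := gi l|have := gi m.-1]; lia.
move=> l lm; rewrite lm; case: (ltnP l.+1 m) => lm'; last by have -> : m.-1 = l by lia.
have gl := gS l lm'; have := gi l lm; have := gi l.+1 lm' => g1 g2.
rewrite -(prednK (leq_ltn_trans (leq0n _) gl)); apply: delta_dec; try lia.
by move=> x ? ?; apply: step; lia.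
Qed.

(** [A] consists of the deltas of the run. A subset of [A] of size [k.-1] is the delta set of some
    [k] vertices of [S] with monotone deltas; that edge is blue, so the subset is not red. *)
Lemma blue_monotone_run M N k (red : {set {set 'I_N}}) (S : {set 'I_M}) p i n :
    1 < k -> M <= 2 ^ N ->
    (forall e : {set 'I_M}, e \subset S -> #|e| = k -> e \notin step_up k M red) ->
    p = predT \/ p = pred0 -> follows p (fun l => deltas S (i + l)) n ->
    i + n < #|S| ->
  exists2 A : {set 'I_N}, #|A| = n &
    forall e : {set 'I_N}, e \subset A -> #|e| = k.-1 -> e \notin red.
Proof.
move=> k1 MN blue Hp pa iS; pose a := deltas S.
have inj := follows_inj Hp pa.
have aN l : l < i + n -> a l < N by move=> ?; apply: deltas_lt => //; lia.
have ainj : {in iota i n &, injective a}.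
  move=> x y; rewrite !mem_iota => hx hy; rewrite /a.
  have := inj (x - i) (y - i); rewrite !inE !subnKC; [|lia|lia].
  by move=> H /H; lia.
have lti l : l \in iota i n -> l < i + n by rewrite mem_iota; lia.
exists (setof N [seq a l | l <- iota i n]).
  rewrite card_setof ?size_map ?size_iota ?map_inj_in_uniq ?iota_uniq //.
  by move=> _ /mapP[l /lti/aN + ->].
(* [s] lists positions rather than values, since a decreasing run reverses the order of the
   values. *)
move=> e eA ce; pose s := [seq l <- iota i n | a l \in elts e].
have es : e = setof N [seq a l | l <- s].
  apply/setP => x; rewrite inE; apply/idP/mapP => [xe|[l + ax]]; last first.
    by rewrite mem_filter -ax mem_elts => /andP[].
  have := subsetP eA x xe; rewrite inE => /mapP[l li ax]; exists l => //.
  by rewrite mem_filter -ax mem_elts xe.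
have sze : size s = k.-1.
  rewrite -ce es card_setof ?size_map //.
    rewrite map_inj_in_uniq ?filter_uniq ?iota_uniq // => x y.
    by rewrite !mem_filter => /andP[_ ?] /andP[_ ?]; apply: ainj.
  by move=> _ /mapP[l + ->]; rewrite mem_filter => /andP[_ /lti/aN].
have srt : sorted ltn s by apply: sorted_filter (iota_ltn_sorted _ _); apply: ltn_trans.
have /(sortedP 0) gS := srt.
have bd l : l < k.-1 -> i <= nth 0 s l < i + n.
  move=> lk; have /(mem_nth 0) : l < size s by rewrite sze.
  by rewrite mem_filter mem_iota => /andP[].
have [|||h [hS he hd]] := @monotone_subrun M S p i n (nth 0 s) k.-1 Hp pa iS.
- by lia.
- by move=> l lk; apply: gS; rewrite sze.
- exact: bd.
have kE : k.-1.+1 = k by lia.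
rewrite kE in hS he.
have [sub ck _] := subvtxP hS he.
have dE l : l < k.-1 -> deltas (subvtx S h k) l = a (nth 0 s l).
  by move=> lk; rewrite subvtx_deltas // ?hd //; lia.
have := blue _ sub ck; rewrite !inE ck eqxx /= negb_or negb_and => /andP[/orP[/negP nm|+] _].
  case: nm; suff : follows p (deltas (subvtx S h k)) k.-1.
    by case: Hp => ->; move=> ->; rewrite ?orbT.
  apply/followsP => l lk; rewrite !dE ?(ltnW lk) //.
  have b1 := bd l (ltnW lk); have b2 := bd _ lk.
  have gl : nth 0 s l < nth 0 s l.+1 by apply: gS; rewrite sze.
  have E x : i <= x -> a x = a (i + (x - i)) by move=> ?; rewrite subnKC.
  rewrite (E (nth 0 s l)) ?(E (nth 0 s l.+1)); [|lia|lia].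
  case: Hp pa => -> pa /=; [apply: (follows_inc pa)|apply: (follows_dec pa)]; lia.
suff -> : mkseq (deltas (subvtx S h k)) k.-1 = [seq a l | l <- s] by rewrite -es.
apply: (@eq_from_nth _ 0); first by rewrite size_mkseq size_map sze.
by move=> l; rewrite size_mkseq => lk; rewrite nth_mkseq // dE // (nth_map 0) ?sze.
Qed.

(** The first half contains a descent and the second half an ascent; the first ascent after that
    descent starts at a local minimum. *)
Lemma local_min_exists (a : nat -> nat) i n :
  (forall l, l.+1 < 2 * n -> a (i + l) <> a (i + l).+1) ->
  ~~ follows predT (fun l => a (i + l)) n ->
  ~~ follows pred0 (fun l => a (i + n + l)) n ->
  exists q, [&& i < q, q.+1 < i + 2 * n, a q < a q.-1 & a q < a q.+1].
Proof.
move=> neq /allPn[x + nx] /allPn[y + ny]; rewrite !mem_iota /= => hx hy.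
rewrite /= in nx ny.
have ex : exists z, (i + x < z) && (a z < a z.+1).
  exists (i + n + y); have := neq (n + y); rewrite addnA -addnS; move: ny.
  by rewrite !addnS; lia.
case: (ex_minnP ex) => q /andP[xq up] minq.
have qle : q <= i + n + y.
  apply: minq; have := neq (n + y); rewrite addnA; move: ny.
  by rewrite !addnS; lia.
exists q; apply/and4P; split=> //; try lia.
have [E|ne] := eqVneq q (i + x).+1.
  rewrite E /=; have := neq x; move: nx; rewrite !addnS; lia.
have := minq q.-1; have := neq (q.-1 - i).
rewrite subnKC; last lia.
by rewrite prednK; last lia; lia.
Qed.

Lemma blue_zigzag M N k (red : {set {set 'I_N}}) (S : {set 'I_M}) n :
    0 < n -> 5 < k -> #|S| = 2 * k * n ->
    (forall e : {set 'I_M}, e \subset S -> #|e| = k -> e \notin step_up k M red) ->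
  exists p i, [/\ p = predT \/ p = pred0,
    follows p (fun l => deltas S (i + l)) n & i + n < #|S|].
Proof.
move=> n0 k5 cS blue; pose a := deltas S.
pose mono i := follows predT (fun l => a (i + l)) n || follows pred0 (fun l => a (i + l)) n.
have [/hasP[i + Hi]|/hasPn Nmono] := boolP (has mono (iota 0 (#|S| - n))).
  rewrite mem_iota => hi; case/orP: Hi => Hi.
    by exists predT, i; split; [left| |lia].
  by exists pred0, i; split; [right| |lia].
have nmono i : i + n < #|S| ->
    ~~ follows predT (fun l => a (i + l)) n /\ ~~ follows pred0 (fun l => a (i + l)) n.
  move=> iS; apply/andP; rewrite -negb_or; apply: Nmono; rewrite mem_iota; lia.
(* The implication makes a witness exist for every [l], so that [ex_minn] yields a total
   function. *)
have exq l : exists q, (l.+1 < k) ==> [&& l * (2 * n) < q, q.+1 < l.+1 * (2 * n),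
    a q < a q.-1 & a q < a q.+1].
  case: (ltnP l.+1 k) => /= lk; last by exists 0.
  have lS : l.+1 * (2 * n) + 2 * n <= #|S| by rewrite cS; nia.
  rewrite [l.+1 * _]mulSn addnC; apply: local_min_exists.
  - by move=> x xn; apply: deltas_neq; lia.
  - by apply: (nmono _ _).1; lia.
  - by apply: (nmono _ _).2; lia.
pose q l := ex_minn (exq l).
have qP l : l.+1 < k -> [&& l * (2 * n) < q l, (q l).+1 < l.+1 * (2 * n),
    a (q l) < a (q l).-1 & a (q l) < a (q l).+1].
  by move=> lk; rewrite /q; case: ex_minnP => x; rewrite lk.
(* Both endpoints of each minimal delta are taken. Even deltas are then the minima, and odd ones the
   maxima over the gaps between successive minima. *)
pose h l := q l./2 + odd l.
have hS l : l.+1 < k -> h l < h l.+1.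
  move=> lk; rewrite /h /= uphalf_half; case: (odd l) => /=; last by rewrite add0n; lia.
  rewrite add1n; have := qP l./2; have := qP (l./2).+1; nia.
have he l : l < k -> h l < #|S|.
  move=> lk; have := qP l./2; rewrite cS /h; case: (odd l) => /=; nia.
have [sub ck _] := subvtxP hS he.
have := blue _ sub ck; rewrite !inE ck eqxx /= negb_or => /andP[_ /negP[]].
apply/followsP => l lk; rewrite !subvtx_deltas //; try lia.
rewrite /zigzag /h /= uphalf_half.
have hl : l./2 <= l by lia.
have /and4P[_ x2 _ x4] := qP l./2 ltac:(lia).
have /and4P[y1 y2 y3 _] := qP (l./2).+1 ltac:(lia).
have yS := he l.+2 ltac:(lia).
have xy : (q l./2).+1 < q (l./2).+1 by lia.
have yE : (q (l./2).+1).-1.+1 = q (l./2).+1 by lia.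
have yS' : q (l./2).+1 < #|S| by move: yS; rewrite /h /=; lia.
(* The gap delta dominates the deltas next to both minima, hence exceeds both minima. *)
have U m : (q l./2).+1 <= m -> m <= (q (l./2).+1).-1 ->
    a m <= delta (vtx S (q l./2).+1) (vtx S (q (l./2).+1)).
  move=> m1 m2; rewrite -yE; apply: deltas_le_delta => //.
  by rewrite yE.
case ol: (odd l) => /=; rewrite ?add0n ?add1n !addn0 !addn1.
  by apply: leq_trans y3 _; apply: U => //; lia.
by apply: leq_trans x4 _; apply: U => //; lia.
Qed.

(** * Assembling the lower bound *)

(** An empty vertex set has no subset of positive size. Positivity keeps the truncated [r - 1]
    strictly below [r]. *)
Lemma ramsey_H_gt0 k t n : 0 < n -> t <= k.+1 -> 0 < ramsey_H k t n.
Proof.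
move=> n0 tk; have [|+ _] := @ramsey_numberP k k.+1 t n; first by rewrite binSn.
rewrite /ramsey_H lt0n => arrow; apply/eqP => E; move: arrow; rewrite E.
have no (S : {set 'I_0}) m : 0 < m -> (#|S| == m) = false.
  move=> m0; apply: ltn_eqF; apply: leq_ltn_trans m0.
  by rewrite -[X in _ <= X](card_ord 0) max_card.
move=> /forallP/(_ set0); rewrite sub0set /=.
by case/orP=> /existsP[S]; rewrite no.
Qed.

Theorem theorem3p2 (k t : nat) (hk : 6 <= k) (ht : 4 <= t <= k.+1)
    (htk : ~ (t = 4 /\ odd k)) (n : nat) (hn : 0 < n) :
  2 ^ (ramsey_H (k - 1) (t - 1) n - 1) < ramsey_H k t (2 * k * n).
Proof.
rewrite ltnNge; apply/negP => le_M.
have kE : (k - 1).+1 = k by lia.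
have rpos : 0 < ramsey_H (k - 1) (t - 1) n by apply: ramsey_H_gt0; lia.
have [|_ min_r] := @ramsey_numberP (k - 1) (k - 1).+1 (t - 1) n; first by rewrite binSn; lia.
have [|arrow _] := @ramsey_numberP k k.+1 t (2 * k * n); first by rewrite binSn; lia.
set N := ramsey_H (k - 1) (t - 1) n - 1 in le_M.
have : ~~ ramsey_arrow (k - 1) (k - 1).+1 (t - 1) n N.
  by apply/negP => /min_r; rewrite -/(ramsey_H _ _ _) /N; lia.
rewrite kE; case/forallPn => red; rewrite negb_imply negb_or.
move=> /and3P[_ /existsPn noblue /existsPn nored].
have sparse (A : {set 'I_N}) : #|A| = k -> #|induced_edges red A| < t - 1.
  by move=> cA; have := nored A; rewrite cA eqxx /= -ltnNge.
move: arrow le_M; rewrite -/(ramsey_H _ _ _); set M := ramsey_H _ _ _ => arrow le_M.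
(* By [le_M] the vertices of ['I_M] are numbers below [2 ^ N], so their deltas are points of
   ['I_N]. *)
move/forallP: arrow => /(_ (step_up k M red)).
have -> : step_up k M red \subset complete_kgraph k M.
  by apply/subsetP => e; rewrite inE => /andP[].
case/orP => /existsP[S /andP[/eqP cS HS]]; last first.
  (* Given [4 <= t], this fails exactly in the excluded case of [t = 4] and odd [k]. *)
  have kt : 3 + odd k < t by move: htk; case: (odd k); lia.
  by move: HS; rewrite leqNgt (step_up_sparse _ kt le_M cS sparse).
have blue (e : {set 'I_M}) : e \subset S -> #|e| = k -> e \notin step_up k M red.
  move=> eS ce; have /(subsetP HS) : e \in induced_edges (complete_kgraph k M) S.
    by rewrite !inE ce eqxx.
  by rewrite inE => /andP[].
have [p [i [Hp mono iS]]] := blue_zigzag hn hk cS blue.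
have [|A cA blueA] := blue_monotone_run _ le_M blue Hp mono iS; first by lia.
have := noblue A; rewrite cA eqxx /= => /negP[].
apply/subsetP => e; rewrite !inE => /andP[ce eA]; rewrite ce andbT.
by apply: blueA => //; rewrite (eqP ce) subn1.
Qed.
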